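(* Let $N\ge1$ and let $\gamma\in\mathbb{C}\setminus\{0\}$ be such that $\Gamma_\gamma$ is periodic of period $2N$. Then $\Gamma_\gamma$ has at least $N$ pairwise distinct Nielsen classes of parabolic generating pairs.
   Context: $\Gamma_\gamma=\langle \pm\begin{pmatrix}1&1\\0&1\end{pmatrix},\pm\begin{pmatrix}1&0\\ \gamma&1\end{pmatrix}\rangle\subset PSL(2,\mathbb{C})$. For $x,y\in PSL(2,\mathbb{C})$, $\gamma(x,y)=\operatorname{tr}[x,y]-2$. A good word is a reduced word $w=a^{m_1}ba^{m_2}b\cdots ba^{m_n}$ in $\langle a,b\mid b^2=1\rangle$ with $n\ge3$ and $m_i\ne0$ for $2\le i\le n-1$; its word polynomial $p_w\in\mathbb{Z}[z]$ is the unique polynomial with $\gamma(f,w(f,\phi))=p_w(\gamma(f,\phi))$ for every parabolic $f$ and every order-two elliptic $\phi$ in $PSL(2,\mathbb{C})$ ($w(f,\phi)$: substitute $a=f,b=\phi$). $\Gamma_\gamma$ is periodic of period $m$ if there is a good word $w$ such that $\gamma$ is a periodic point of $p_w$ of exact period $m$, i.e. $\gamma,p_w(\gamma),\dots,p_w^{(m-1)}(\gamma)$ are pairwise distinct and $p_w^{(m)}(\gamma)=\gamma$ ($p^{(k)}$ the $k$-th iterate). A parabolic generating pair of $\Gamma$ is a pair of parabolic elements generating $\Gamma$; two generating pairs lie in the same Nielsen class if related by finitely many elementary Nielsen transformations $(x,y)\mapsto(y,x),(x^{-1},y),(x,xy)$; $\operatorname{tr}[x,y]-2$ is a Nielsen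 class invariant. *)

(* Defs.v *)
From HB Require Import structures.
From mathcomp Require Import all_boot all_order all_algebra.
From mathcomp Require Import reals complex.
From Stdlib Require Import Relations.
Set Implicit Arguments. Unset Strict Implicit. Unset Printing Implicit Defensive.
Import Order.TTheory GRing.Theory Num.Theory.
Local Open Scope ring_scope.

Section PSL2.
Variable C : fieldType.

(* Elements of PSL(2,C) are represented by matrices of SL(2,C); a matrix
   and its negative represent the same element of PSL(2,C). *)
Definition SL2 (x : 'M[C]_2) : Prop := \det x = 1.

(* gamma(x,y) = tr[x,y] - 2, with [x,y] = x y x^-1 y^-1
   (well defined on PSL(2,C)). *)
Definition gam (x y : 'M[C]_2) : C := \tr (x * y * x^-1 * y^-1) - 2.

Definition parabolic (x : 'M[C]_2) : Prop :=
  SL2 x /\ (\tr x = 2 \/ \tr x = -2) /\ x <> 1 /\ x <> -1.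

Definition order_two (x : 'M[C]_2) : Prop :=
  SL2 x /\ (x ^+ 2 = 1 \/ x ^+ 2 = -1) /\ x <> 1 /\ x <> -1.

(* Preimage in SL(2,C) of the subgroup of PSL(2,C) generated by the images
   of the matrices satisfying S: closure under products and inverses,
   containing 1 and -1. *)
Inductive gen (S : 'M[C]_2 -> Prop) : 'M[C]_2 -> Prop :=
  | gen_in x : S x -> gen S x
  | gen_one : gen S 1
  | gen_negone : gen S (-1)
  | gen_mul x y : gen S x -> gen S y -> gen S (x * y)
  | gen_inv x : gen S x -> gen S (x^-1).

Definition matA : 'M[C]_2 := 1 + delta_mx 0 1.
Definition matB (g : C) : 'M[C]_2 := 1 + g *: delta_mx 1 0.
Definition Gamma (g : C) : 'M[C]_2 -> Prop :=
  gen (fun x => x = matA \/ x = matB g).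

(* (x,y) is a parabolic generating pair of the group G (given by its
   preimage in SL(2,C)) *)
Definition parabolic_gen_pair (G : 'M[C]_2 -> Prop) (p : 'M[C]_2 * 'M[C]_2)
  : Prop :=
  parabolic p.1 /\ parabolic p.2 /\
  (forall z, gen (fun x => x = p.1 \/ x = p.2) z <-> G z).

(* Elementary Nielsen transformations, together with the sign changes
   which do not change the pair as a pair of elements of PSL(2,C). *)
Inductive nielsen_step : 'M[C]_2 * 'M[C]_2 -> 'M[C]_2 * 'M[C]_2 -> Prop :=
  | ns_swap x y : nielsen_step (x, y) (y, x)
  | ns_inv x y : nielsen_step (x, y) (x^-1, y)
  | ns_mul x y : nielsen_step (x, y) (x, x * y)
  | ns_sign1 x y : nielsen_step (x, y) (- x, y)
  | ns_sign2 x y : nielsen_step (x, y) (x, - y).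

Definition nielsen_equiv := clos_refl_trans _ nielsen_step.

(* Good words a^{m_1} b a^{m_2} b ... b a^{m_n}, given by (m_1,...,m_n) *)
Definition good_word (ms : seq int) : Prop :=
  (3 <= size ms)%N /\
  (forall i, (1 <= i)%N -> (i < (size ms).-1)%N -> nth 0 ms i != 0).

Fixpoint eval_word_aux (f phi : 'M[C]_2) (acc : 'M[C]_2) (ms : seq int)
  : 'M[C]_2 :=
  match ms with
  | [::] => acc
  | m :: ms' => eval_word_aux f phi (acc * phi * f ^ m) ms'
  end.
Definition eval_word (ms : seq int) (f phi : 'M[C]_2) : 'M[C]_2 :=
  match ms with
  | [::] => 1
  | m :: ms' => eval_word_aux f phi (f ^ m) ms'
  end.

Definition word_poly (ms : seq int) (p : {poly int}) : Prop :=
  forall f phi : 'M[C]_2, parabolic f -> order_two phi ->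
    gam f (eval_word ms f phi) = (map_poly intr p).[gam f phi].

Definition exact_period (q : {poly C}) (z : C) (m : nat) : Prop :=
  (forall i j, (i < j)%N -> (j < m)%N ->
     iter i (fun t => q.[t]) z <> iter j (fun t => q.[t]) z) /\
  iter m (fun t => q.[t]) z = z.

Definition periodic (g : C) (m : nat) : Prop :=
  exists ms p, good_word ms /\ word_poly ms p /\
    exact_period (map_poly intr p) g m.

End PSL2.

(* Main.v *)
Require Import Defs.
From HB Require Import structures.
From mathcomp Require Import all_boot all_order all_algebra.
From mathcomp Require Import reals complex ring.
From Stdlib Require Import Relations.
Set Implicit Arguments. Unset Strict Implicit. Unset Printing Implicit Defensive.
Import Order.TTheory GRing.Theory Num.Theory.
Local Open Scope ring_scope.

(** Let [A] and [B_g] be the generators of [Gamma g] and [T_s] the translation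
    by [s], let [p] be the word polynomial and [g_k] its iterates at [g].  If
    [g_k <> 0], a half turn [phi] swaps [A] and [B_(g_k)] up to inversion, so
    [w = w(A, phi)] normalizes [Gamma g_k], and [w A^-1 w^-1] is a conjugate
    of [B_(g_(k+1))] by a translation.  So [Gamma g_k] contains a translation
    conjugate of [Gamma g_(k+1)], and around the cycle [Gamma g] contains
    [T_t (Gamma g) T_-t] for some [t].  The inclusion need not be an equality
    for an arbitrary linear group, but conjugating it by diag(1,-1), which
    normalizes [Gamma g], gives the same inclusion for [-t], hence equality
    throughout.  Each [g_k] thus provides a parabolic generating pair of
    [Gamma g], with [gam = g_k^2]; and [2N] distinct numbers have at least [N]
    distinct squares. *)

Section Matrices.
Variable C : fieldType.
Implicit Types (a b c d g h s t : C) (x y z u : 'M[C]_2).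

(** * Entrywise computation with 2 by 2 matrices *)

Definition mx2 a b c d : 'M[C]_2 :=
  \matrix_(i, j) (if i == 0 then if j == 0 then a else b
                  else if j == 0 then c else d).

Lemma mx2_eta x : exists a b c d, x = mx2 a b c d.
Proof.
exists (x 0 0), (x 0 1), (x 1 0), (x 1 1); apply/matrixP => i j; rewrite mxE.
have ord2 (k : 'I_2) : k = if k == 0 then 0 else 1.
  by apply/val_inj; case: k => [[|[|//]] ?].
by rewrite {1}(ord2 i) {1}(ord2 j); case: eqP; case: eqP.
Qed.

Lemma mul_mx2 a b c d a' b' c' d' :
  mx2 a b c d * mx2 a' b' c' d' =
  mx2 (a * a' + b * c') (a * b' + b * d') (c * a' + d * c') (c * b' + d * d').
Proof.
apply/matrixP => i j; rewrite !mxE big_ord_recl big_ord1 !mxE /=.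
by case: eqP; case: eqP.
Qed.

Lemma one_mx2 : 1 = mx2 1 0 0 1.
Proof. by apply/matrixP => -[[|[|//]] ?] [[|[|//]] ?]; rewrite !mxE. Qed.

Lemma opp_mx2 a b c d : - mx2 a b c d = mx2 (- a) (- b) (- c) (- d).
Proof. by apply/matrixP => i j; rewrite !mxE; case: eqP; case: eqP. Qed.

Lemma det_mx2 a b c d : \det (mx2 a b c d) = a * d - b * c.
Proof. by rewrite (expand_det_row _ 0) big_ord_recl big_ord1 !mxE /=
  /cofactor !det_mx11 !mxE /= expr0 expr1 mul1r mulN1r mulrN. Qed.

Lemma tr_mx2 a b c d : \tr (mx2 a b c d) = a + d.
Proof. by rewrite /mxtrace big_ord_recl big_ord1 !mxE. Qed.

Lemma mx2_inj a b c d a' b' c' d' :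
  mx2 a b c d = mx2 a' b' c' d' -> [/\ a = a', b = b', c = c' & d = d'].
Proof.
by move=> e; split; [have := congr1 (fun x => x 0 0) e
  | have := congr1 (fun x => x 0 1) e | have := congr1 (fun x => x 1 0) e
  | have := congr1 (fun x => x 1 1) e]; rewrite !mxE.
Qed.

Lemma SL2_unit x : SL2 x -> x \is a GRing.unit.
Proof. by rewrite /SL2 => dx; rewrite unitmxE dx unitr1. Qed.

Lemma inv_mx2 a b c d : a * d - b * c = 1 ->
  (mx2 a b c d)^-1 = mx2 d (- b) (- c) a.
Proof.
move=> e; apply: (mulrI (SL2_unit (x := mx2 a b c d) _)).
  by rewrite /SL2 det_mx2.
rewrite divrr; last by apply: SL2_unit; rewrite /SL2 det_mx2.
by rewrite mul_mx2 one_mx2; congr mx2; rewrite -?e; ring.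
Qed.

Definition transl t : 'M[C]_2 := mx2 1 t 0 1.

Lemma matAE : matA C = transl 1.
Proof.
by apply/matrixP => -[[|[|//]] ?] [[|[|//]] ?]; rewrite !mxE /= ?addr0 ?add0r.
Qed.

Lemma matBE g : matB g = mx2 1 0 g 1.
Proof.
apply/matrixP => -[[|[|//]] ?] [[|[|//]] ?];
  by rewrite !mxE /= ?(mulr0, mulr1, addr0, add0r).
Qed.

Lemma translD s t : transl s * transl t = transl (s + t).
Proof. by rewrite mul_mx2; congr mx2; ring. Qed.

Lemma transl0 : transl 0 = 1.
Proof. by rewrite one_mx2. Qed.

Lemma translV t : (transl t)^-1 = transl (- t).
Proof. by rewrite inv_mx2 ?oppr0 //; ring. Qed.

(** * Conjugates of generated groups and inclusions between them *)

Lemma gen_conj (S S' : 'M[C]_2 -> Prop) u : u \is a GRing.unit ->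
  (forall x, S x -> gen S' (u * x * u^-1)) ->
  forall x, gen S x -> gen S' (u * x * u^-1).
Proof.
move=> uu HS x; elim=> {x} [x /HS // | | |x y _ IHx _ IHy|x _ IHx].
- by rewrite mulr1 divrr //; apply: gen_one.
- by rewrite mulrN1 mulNr divrr //; apply: gen_negone.
- have -> : u * (x * y) * u^-1 = (u * x * u^-1) * (u * y * u^-1).
    by rewrite !mulrA mulrVK.
  exact: gen_mul.
- have [ux|nux] := boolP (x \is a GRing.unit).
    have -> : u * x^-1 * u^-1 = (u * x * u^-1)^-1.
      by rewrite !invrM ?invrK ?unitrMl ?unitrV // mulrA.
    exact: gen_inv.
  (* [gen] also allows inverses of singular matrices; there [x^-1] is [x], so the induction
     hypothesis applies. *)
  by rewrite invr_out.
Qed.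

(** A single word yields only an inclusion; two opposite inclusions are upgraded to an equality in
    [gen_pair_of_sub_conj]. *)
Definition sub_conj g h s :=
  forall x, Gamma h x -> Gamma g (transl s * x * transl (- s)).

Lemma Gamma_A g : Gamma g (transl 1).
Proof. by apply: gen_in; left; rewrite matAE. Qed.

Lemma Gamma_B g : Gamma g (mx2 1 0 g 1).
Proof. by apply: gen_in; right; rewrite matBE. Qed.

Lemma Gamma_Bn g : Gamma g (mx2 1 0 (- g) 1).
Proof.
have -> : mx2 1 0 (- g) 1 = (mx2 1 0 g 1)^-1 by rewrite inv_mx2 ?oppr0 //; ring.
exact/gen_inv/Gamma_B.
Qed.

Lemma Gamma_An g : Gamma g (transl (- 1)).
Proof. by rewrite -translV; apply/gen_inv/Gamma_A. Qed.

Lemma SL2_transl t : SL2 (transl t).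
Proof. by rewrite /SL2 det_mx2; ring. Qed.

(** Translations commute, so [matA] is its own conjugate and only the second generator has to be
    checked. *)
Lemma sub_conj_gens g h s :
  Gamma g (transl s * mx2 1 0 h 1 * transl (- s)) -> sub_conj g h s.
Proof.
move=> HB x; rewrite -translV; apply: gen_conj.
  exact/SL2_unit/SL2_transl.
move=> {}x; rewrite -/(Gamma g) translV => -[] ->; last by rewrite (matBE h).
by rewrite matAE !translD addrAC subrr add0r; apply: Gamma_A.
Qed.

Lemma sub_conj0 g : sub_conj g g 0.
Proof. by move=> x; rewrite oppr0 transl0 mul1r mulr1. Qed.

Lemma sub_conj_trans g h k s t :
  sub_conj g h s -> sub_conj h k t -> sub_conj g k (s + t).
Proof.
move=> gh hk x /hk/gh; rewrite !mulrA translD -!mulrA translD !mulrA.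
by rewrite [_ - s]addrC opprD.
Qed.

(* Conjugation by diag(1,-1) inverts both generators of Gamma and every
   translation. *)
Lemma sub_conjN g h s : sub_conj g h s -> sub_conj g h (- s).
Proof.
pose D := mx2 1 0 0 (-1).
have DD : D * D = 1 by rewrite mul_mx2 one_mx2; congr mx2; ring.
have uD : D \is a GRing.unit by apply/unitrP; exists D.
have DV : D^-1 = D by apply: (mulrI uD); rewrite divrr.
have HD k x : Gamma k x -> Gamma k (D * x * D).
  rewrite -{2}DV; apply: gen_conj => // {}x; rewrite -/(Gamma k) DV => -[] ->.
    have -> : D * matA C * D = transl (- 1).
      by rewrite matAE !mul_mx2; congr mx2; ring.
    exact: Gamma_An.
  have -> : D * matB k * D = mx2 1 0 (- k) 1.
    by rewrite matBE !mul_mx2; congr mx2; ring.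
  exact: Gamma_Bn.
have HT t : transl (- t) = D * transl t * D by rewrite !mul_mx2; congr mx2; ring.
move=> gh x /HD/gh/HD; rewrite !HT !mulrA.
have K y : y * D * D = y by rewrite -mulrA DD mulr1.
by rewrite !K.
Qed.

(** * Commutator traces and parabolic generating pairs *)

Lemma gam_transl_mx2 a b c d :
  a * d - b * c = 1 -> gam (transl 1) (mx2 a b c d) = c ^+ 2.
Proof.
move=> e; rewrite /gam translV (inv_mx2 e) !mul_mx2 tr_mx2.
(* Weighting 2 by the determinant turns the claim into a polynomial identity. *)
have -> : 2 = 2 * (a * d - b * c) by rewrite e mulr1.
by ring.
Qed.

Lemma parabolic_transl : parabolic (transl 1).
Proof.
split; first exact: SL2_transl.
split; first by left; rewrite tr_mx2.
by split; rewrite one_mx2 ?opp_mx2 => /mx2_inj[_ /eqP];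
  rewrite ?oppr0 oner_eq0.
Qed.

Lemma parabolic_conj s h : h != 0 ->
  parabolic (transl s * mx2 1 0 h 1 * transl (- s)).
Proof.
move=> h0; rewrite !mul_mx2.
split; first by rewrite /SL2 det_mx2; ring.
split; first by left; rewrite tr_mx2; ring.
have e : (0 * 1 + 1 * h) * 1 + (0 * 0 + 1 * 1) * 0 = h by ring.
by split; rewrite one_mx2 ?opp_mx2 => /mx2_inj[_ _ /eqP];
  rewrite e ?oppr0 (negPf h0).
Qed.

Lemma SL2M x y : SL2 x -> SL2 y -> SL2 (x * y).
Proof. by rewrite /SL2 det_mulmx => -> ->; rewrite mulr1. Qed.

Lemma SL2V x : SL2 x -> SL2 x^-1.
Proof. by rewrite /SL2 det_inv => ->; rewrite invr1. Qed.

Lemma SL2N x : SL2 x -> SL2 (- x).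
Proof.
have [a [b [c [d ->]]]] := mx2_eta x.
by rewrite /SL2 opp_mx2 !det_mx2 => <-; ring.
Qed.

Lemma gen_pair_of_sub_conj g h s t : h != 0 ->
  sub_conj g h s -> sub_conj h g t ->
  parabolic_gen_pair (Gamma g)
    (matA C, transl s * matB h * transl (- s)).
Proof.
move=> h0 gh hg; rewrite matAE matBE; split; first exact: parabolic_transl.
split=> [|z /=]; first exact: parabolic_conj.
split.
  elim=> {z} [z [] ->| | |x y _ IHx _ IHy|x _ IHx].
  - exact: Gamma_A.
  - exact/gh/Gamma_B.
  - exact: gen_one.
  - exact: gen_negone.
  - exact: gen_mul.
  - exact: gen_inv.
move=> Gz.
(* The loop from [g] through [h] back to [g] shifts by [s + t]. Reversing that shift with
   [sub_conjN] and composing with [hg] leaves [t - (s + t) = - s], the exact reverse of [gh]. *)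
have hgs : sub_conj h g (- s).
  have := sub_conj_trans hg (sub_conjN (sub_conj_trans gh hg)).
  by rewrite opprD addrCA subrr addr0.
have uT := SL2_unit (SL2_transl s).
have := hgs _ Gz; rewrite opprK => /(gen_conj uT (S' := fun x => x = transl 1 \/
   x = transl s * mx2 1 0 h 1 * transl (- s))).
rewrite -translV !mulrA divrr // mul1r mulrK //; apply=> x [] ->.
  rewrite translV matAE !translD addrAC subrr add0r.
  by apply: gen_in; left.
by apply: gen_in; right; rewrite matBE.
Qed.

Lemma gam_pair h s :
  gam (matA C) (transl s * matB h * transl (- s)) = h ^+ 2.
Proof.
rewrite matAE matBE !mul_mx2 gam_transl_mx2; first by ring.
by ring.
Qed.

(** * Nielsen invariance of the commutator trace *)

Lemma tr_comm_swap x y : SL2 x -> SL2 y ->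
  \tr (y * x * y^-1 * x^-1) = \tr (x * y * x^-1 * y^-1).
Proof.
have [a [b [c [d ->]]]] := mx2_eta x; have [a' [b' [c' [d' ->]]]] := mx2_eta y.
rewrite /SL2 !det_mx2 => e e'.
by rewrite (inv_mx2 e) (inv_mx2 e') !mul_mx2 !tr_mx2; ring.
Qed.

(** [x^-1, y] is conjugate to the inverse of [x, y], and inversion preserves traces in SL2. *)
Lemma tr_comm_inv x y : SL2 x -> SL2 y ->
  \tr (x^-1 * y * x^-1^-1 * y^-1) = \tr (x * y * x^-1 * y^-1).
Proof.
rewrite invrK; have [a [b [c [d ->]]]] := mx2_eta x.
have [a' [b' [c' [d' ->]]]] := mx2_eta y.
rewrite /SL2 !det_mx2 => e e'.
by rewrite (inv_mx2 e) (inv_mx2 e') !mul_mx2 !tr_mx2; ring.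
Qed.

Lemma nielsen_equiv_gam (p q : 'M[C]_2 * 'M[C]_2) : nielsen_equiv p q ->
  SL2 p.1 -> SL2 p.2 -> gam q.1 q.2 = gam p.1 p.2.
Proof.
move=> pq s1 s2.
(* Determinant 1 is carried along the chain, because the swap, inversion and product steps rely on
   it. *)
suff [] : [/\ SL2 q.1, SL2 q.2 & gam q.1 q.2 = gam p.1 p.2] by [].
elim: pq s1 s2 => {p q} [p q st sx sy|//|p q r _ IHpq _ IHqr s1 s2]; last first.
  have [s1' s2' e1] := IHpq s1 s2; have [s1'' s2'' e2] := IHqr s1' s2'.
  by split=> //; rewrite e2.
have gamN1 x y : gam (- x) y = gam x y by rewrite /gam invrN !(mulrN, mulNr) opprK.
have gamN2 x y : gam x (- y) = gam x y by rewrite /gam invrN !(mulrN, mulNr) opprK.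
case: st sx sy => x y /= sx sy; split=> //;
  do ?[exact: SL2M | exact: SL2V | exact: SL2N];
  rewrite ?gamN1 ?gamN2 //; congr (_ - 2).
- exact: tr_comm_swap.
- exact: tr_comm_inv.
(* The commutator [x, x y] is the conjugate of [x, y] by x. *)
have -> : x * (x * y) * x^-1 * (x * y)^-1 = x * (x * y * x^-1 * y^-1) * x^-1.
  by rewrite invrM ?SL2_unit // !mulrA.
by rewrite mxtrace_mulC -[_ *m _]/(x^-1 * _) mulKr ?SL2_unit.
Qed.

End Matrices.

(** * Words in a parabolic and a half turn *)

Section Words.
Variable C : numClosedFieldType.
Implicit Types (a b c d g h s t : C) (x y z u : 'M[C]_2).

(** A word is a product of copies of [x], [x^-1] and [y]. This serves for upper triangular matrices
    and for normalizers. *)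
Lemma eval_word_ind (P : 'M[C]_2 -> Prop) x y ms :
  P 1 -> (forall u z, P u -> P z -> P (u * z)) -> P x -> P x^-1 -> P y ->
  P (eval_word ms x y).
Proof.
move=> P1 PM Px Pxv Py.
have PX u n : P u -> P (u ^+ n).
  by move=> Pu; elim: n => [//|n IH]; rewrite exprS; apply: PM.
have Pz (m : int) : P (x ^ m).
  by case: m => n; [apply: PX | rewrite NegzE -exprnN -exprVn; apply: PX].
case: ms => [//|m ms] /=; move: (x ^ m) (Pz m).
by elim: ms => [//|k ms IH] acc Pacc /=; apply: IH; apply: (PM) => //; apply: PM.
Qed.

(* Evaluate at a half turn fixing the fixed point of the parabolic: then the
   whole word is upper triangular. *)
Lemma word_poly0 ms (p : {poly int}) : @word_poly C ms p ->
  (map_poly intr p).[0 : C] = 0.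
Proof.
pose P x := exists a b d, x = mx2 a b 0 d /\ a * d = 1.
have P_gam x : P x -> gam (transl 1) x = 0.
  by case=> a [b [d [-> e]]]; rewrite gam_transl_mx2 ?expr0n // mulr0 subr0.
have i2 : - ('i * 'i) = 1 :> C by rewrite -expr2 sqrCi opprK.
pose phi := mx2 ('i : C) 0 0 (- 'i).
have Pphi : P phi by exists 'i, 0, (- 'i); rewrite mulrN.
have n1 : (1 : C) <> -1.
  by move/eqP; rewrite -subr_eq0 opprK -(natrD _ 1 1) pnatr_eq0.
have phi2 : order_two phi.
  split; first by rewrite /SL2 det_mx2 -i2; ring.
  split.
    by right; rewrite expr2 mul_mx2 one_mx2 opp_mx2 -i2; congr mx2; ring.
  split; rewrite /phi one_mx2 ?opp_mx2 => /mx2_inj[e _ _]; rewrite e.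
    by move/esym.
  by rewrite opprK.
move=> /(_ _ _ (parabolic_transl C) phi2); rewrite (P_gam _ Pphi) => <-.
apply: P_gam; apply: eval_word_ind => //.
- by exists 1, 0, 1; rewrite -one_mx2 mulr1.
- move=> _ _ [a [b [d [-> e]]]] [a' [b' [d' [-> e']]]].
  exists (a * a'), (a * b' + b * d'), (d * d'); split.
    by rewrite mul_mx2; congr mx2; ring.
  by rewrite mulrACA e e' mulr1.
- by exists 1, 1, 1; rewrite mulr1.
- by exists 1, (-1), 1; rewrite mulr1 translV.
Qed.

(** Inclusion in one direction is enough: it is stable under products, so it passes to words. *)
Definition normalizes g u :=
  SL2 u /\ forall x, Gamma g x -> Gamma g (u * x * u^-1).

Lemma normalizesM g u z : normalizes g u -> normalizes g z ->
  normalizes g (u * z).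
Proof.
move=> [su nu] [sz nz]; split=> [|x Gx]; first exact: SL2M.
rewrite invrM ?SL2_unit // mulrA -!(mulrA u) [z * x * _]lock !mulrA -lock.
by apply: nu; apply: nz.
Qed.

Lemma normalizes_Gamma g u : SL2 u -> Gamma g u -> normalizes g u.
Proof.
by move=> su Gu; split=> // x Gx; apply: gen_mul; [apply: gen_mul|apply: gen_inv].
Qed.

(** The Moebius map z -> -1/(g z) exchanges infinity and 0, the fixed points of the two generators,
    and carries each generator to the inverse of the other. *)
Lemma normalizes_half_turn g c : c != 0 -> c ^+ 2 = g ->
  normalizes g (mx2 0 (- c^-1) c 0).
Proof.
move=> c0 <-; set phi := mx2 _ _ _ _.
have e : 0 * 0 - (- c^-1) * c = 1 by rewrite mulNr opprK mul0r add0r mulVf.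
have sphi : SL2 phi by rewrite /SL2 det_mx2.
split=> //; apply: gen_conj; first exact: SL2_unit.
move=> x; rewrite -/(Gamma _) (inv_mx2 e) => -[] ->.
  have -> : phi * matA C * mx2 0 (- - c^-1) (- c) 0 = mx2 1 0 (- c ^+ 2) 1.
    by rewrite matAE !mul_mx2; congr mx2; field.
  exact: Gamma_Bn.
have -> : phi * matB (c ^+ 2) * mx2 0 (- - c^-1) (- c) 0 = transl (- 1).
  by rewrite matBE !mul_mx2; congr mx2; field.
exact: Gamma_An.
Qed.

Lemma sub_conj_word_poly g ms (p : {poly int}) : g != 0 -> @word_poly C ms p ->
  (map_poly intr p).[g] != 0 ->
  exists s, sub_conj g (map_poly intr p).[g] s.
Proof.
move=> g0 wp; set h := _.[g] => h0.
have c2 := sqrtCK g; set c := sqrtC g in c2.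
have c0 : c != 0 by rewrite sqrtC_eq0.
set phi := mx2 0 (- c^-1) c 0.
have [sphi nphi] := normalizes_half_turn c0 c2.
have ophi : order_two phi.
  split=> //; split.
    by right; rewrite expr2 mul_mx2 one_mx2 opp_mx2; congr mx2; field.
  by split; rewrite /phi one_mx2 ?opp_mx2 => /mx2_inj[_ _ /eqP];
    rewrite ?oppr0 (negPf c0).
have gphi : gam (transl 1) phi = g.
  by rewrite gam_transl_mx2 //; move: sphi; rewrite /SL2 det_mx2.
have := wp _ _ (parabolic_transl C) ophi; rewrite gphi -/h.
have [] : normalizes g (eval_word ms (transl 1) phi).
  apply: eval_word_ind.
  - by apply: normalizes_Gamma; [apply: det1 | apply: gen_one].
  - exact: normalizesM.
  - by apply: normalizes_Gamma; [apply: SL2_transl | apply: Gamma_A].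
  - by rewrite translV; apply: normalizes_Gamma;
      [apply: SL2_transl | apply: Gamma_An].
  - by [].
have [a [b [d [f ->]]]] := mx2_eta (eval_word ms (transl 1) phi).
rewrite /SL2 det_mx2 => e nW; rewrite gam_transl_mx2 // => dh.
have d0 : d != 0 by move: h0; rewrite -dh expf_eq0.
(* With w the matrix of the word, w A^-1 w^-1 fixes w(infinity) = a / d and has lower-left entry d^2
   = h; moving a / d to 0 by a translation gives [matB h]. *)
exists (a / d); apply: sub_conj_gens.
(* Conjugating A itself would give the entry -d^2. *)
have := nW _ (Gamma_An g); rewrite (inv_mx2 e) -dh.
have -> : mx2 a b d f * transl (- 1) * mx2 f (- b) (- d) a =
    mx2 (a * f - b * d + a * d) (- a ^+ 2) (d ^+ 2) (a * f - b * d - a * d).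
  by rewrite !mul_mx2; congr mx2; ring.
rewrite e; congr (Gamma g _); rewrite !mul_mx2.
by congr mx2; field.
Qed.

End Words.

(** Squaring is at most two-to-one: the entries of [r] are distinct roots of a product of factors
    X^2 - v, one for each distinct square v. *)
Lemma uniq_sqr_size (F : fieldType) (r : seq F) : uniq r ->
  (size r <= 2 * size (undup [seq x ^+ 2 | x <- r]))%N.
Proof.
move=> ur; set S := undup _.
pose P := \prod_(v <- S) ('X^2 - v%:P).
have Pm (s : seq F) : \prod_(v <- s) ('X^2 - v%:P) \is monic.
  by apply: monic_prod => v _; apply: monicXnsubC.
have sP : size P = (2 * size S).+1.
  rewrite /P; elim: (S) => [|v s IH]; first by rewrite big_nil size_poly1.
  by rewrite big_cons size_monicM ?monicXnsubC ?monic_neq0 // IH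
    size_XnsubC //= mulnS.
rewrite -ltnS -sP; apply: max_poly_roots => //; first exact/monic_neq0/Pm.
apply/allP => x xr; rewrite /P /root horner_prod prodf_seq_eq0.
apply/hasP; exists (x ^+ 2).
  by rewrite mem_undup; apply: (map_f (fun x => x ^+ 2)).
by rewrite /= !hornerE subrr.
Qed.

(** * Nielsen classes along a periodic orbit *)

Theorem theorem13 (R : realType) (N : nat) (g : R[i]) :
  (1 <= N)%N -> g != 0 -> periodic g (2 * N) ->
  exists P : 'I_N -> 'M[R[i]]_2 * 'M[R[i]]_2,
    (forall k, parabolic_gen_pair (Gamma g) (P k)) /\
    (forall k l, k != l -> ~ nielsen_equiv (P k) (P l)).
Proof.
move=> N0 g0 [ms [p [_ [wp [inj per]]]]].
set q := map_poly _ p in inj per; pose o k := iter k (fun t => q.[t]) g.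
(* [q] fixes 0 by [word_poly0], so an orbit reaching 0 would stay there and could not return to
   [g]. *)
have o0 k : (k <= 2 * N)%N -> o k != 0.
  move=> kN; apply/eqP => ok0; case/eqP: g0; rewrite -per -(subnK kN).
  rewrite iterD -/(o k) ok0; elim: (_ - _)%N => [//|n IH] /=.
  by rewrite IH; apply: word_poly0 wp.
have sub i j : (i <= j)%N -> (j <= 2 * N)%N -> exists s, sub_conj (o i) (o j) s.
  move=> /subnK <-; elim: (j - i)%N => [|n IH] le.
    by exists 0; apply: sub_conj0.
  have [s gs] := IH (ltnW le).
  have [|t ht] := sub_conj_word_poly (o0 _ (ltnW le)) wp; first exact: (o0 _ le).
  by exists (s + t); apply: sub_conj_trans gs ht.
pose sq := undup [seq x ^+ 2 | x <- mkseq o (2 * N)].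
have sqN : (N <= size sq)%N.
  rewrite -(@leq_pmul2l 2) // -{1}(size_mkseq o (2 * N)); apply: uniq_sqr_size.
  apply/(uniqP 0) => i j; rewrite !inE size_mkseq => iN jN.
  rewrite !nth_mkseq // => oij; case: (ltngtP i j) => // lt.
    by case: (inj i j lt jN).
  by case: (inj j i lt iN).
have pick (k : 'I_N) : exists P : 'M[R[i]]_2 * 'M[R[i]]_2,
    parabolic_gen_pair (Gamma g) P /\ gam P.1 P.2 = nth 0 sq k.
  have : nth 0 sq k \in sq by rewrite mem_nth // (leq_trans _ sqN).
  rewrite mem_undup => /mapP[_ /mapP[i + ->] ->].
  rewrite mem_iota /= add0n => iN.
  (* The arcs of the cycle from [g] to [o i] and from [o i] back to [o (2 * N) = g] supply the two
     opposite inclusions. *)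
  have [s gs] := sub 0%N i (leq0n _) (ltnW iN).
  have [t ht] := sub i (2 * N)%N (ltnW iN) (leqnn _).
  exists (matA _, transl s * matB (o i) * transl (- s)); split.
    by apply: (@gen_pair_of_sub_conj _ g (o i) s t) => //;
      [apply/o0/ltnW | move: ht; rewrite /o per].
  exact: gam_pair.
have [P HP] := fin_all_exists pick.
exists P; split=> [k|k l kl eqv]; first by case: (HP k).
have [[[sk _] [[sk' _] _]] gk] := HP k; have [_ gl] := HP l.
(* Equivalent pairs have equal [gam]; as [sq] has no repetitions, this forces equal indices. *)
have := nielsen_equiv_gam eqv sk sk'; rewrite gk gl => /eqP.
rewrite nth_uniq ?undup_uniq ?(leq_trans _ sqN) // => /eqP/val_inj lk.
by rewrite lk eqxx in kl.
Qed.
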